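(* Let $F$ be the distribution function of a random variable $X>0$ with continuous distribution, let $0<v<1$, and let $N$ have the Sibuya($v$) law, with probability generating function $Q(s)=1-(1-s)^v$. For $c\in(0,1)$, $F$ is $N$-max stable with constant $c$ if and only if $F$ is semi-Weibull($p,\alpha$) with $p=v=c^\alpha$ (i.e. $p=v$ and $\alpha>0$ is determined by $c^\alpha=v$). In particular, $F$ is $N$-max stable with some constant $c\in(0,1)$ if and only if $F$ is semi-Weibull($v,\alpha$) for some $\alpha>0$.
   Context: For a random variable $X>0$ with continuous distribution function $F$, and a $\{1,2,\ldots\}$-valued random variable $N$ independent of $X$ with probability generating function $Q(s)=E[s^N]$, $F$ is called $N$-max stable with constant $c\in(0,1)$ if $Q[F(x)]=F(cx)$ for all $x>0$. A continuous distribution function $F$ on $(0,\infty)$ is semi-Weibull($p,\alpha$), with $0<p<1$ and $\alpha>0$, if $F(x)=1-e^{-\psi(x)}$ for all $x>0$, where $\psi:(0,\infty)\to[0,\infty)$ satisfies $\psi(x)=\psi(p^{1/\alpha}x)/p$ for all $x>0$. *)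

(* Defs.v *)
From HB Require Import structures.
From mathcomp Require Import all_boot all_order all_algebra.
From mathcomp Require Import all_classical all_reals all_analysis.
Set Implicit Arguments.
Unset Strict Implicit.
Unset Printing Implicit Defensive.
Import Order.TTheory GRing.Theory Num.Theory.
Import numFieldTopology.Exports numFieldNormedType.Exports.
Local Open Scope classical_set_scope.
Local Open Scope ring_scope.

(* [cdf X] has values in [\bar R]; they all lie in [0, 1], so that [fine] loses
   nothing. *)
Definition distr_fun d (T : measurableType d) (R : realType)
    (P : probability T R) (X : {RV P >-> R}) (x : R) : R := fine (cdf X x).

Definition independent_RV d (T : measurableType d) (R : realType)
    (P : probability T R) d1 (T1 : measurableType d1) d2
    (T2 : measurableType d2) (X : {RV P >-> T1}) (Y : {RV P >-> T2}) : Prop :=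
  forall (A : set T1) (B : set T2), measurable A -> measurable B ->
    (P (X @^-1` A `&` Y @^-1` B) = P (X @^-1` A) * P (Y @^-1` B))%E.

Definition pgf d (T : measurableType d) (R : realType) (P : probability T R)
    (N : {RV P >-> nat}) (s : R) : \bar R := 'E_P[fun t => s ^+ N t].

(* The values of the generating function on [0, 1] determine the law. *)
Definition sibuya d (T : measurableType d) (R : realType)
    (P : probability T R) (N : {RV P >-> nat}) (v : R) : Prop :=
  forall s : R, 0 <= s <= 1 -> pgf N s = (1 - (1 - s) `^ v)%:E.

Definition N_max_stable d (T : measurableType d) (R : realType)
    (P : probability T R) (N : {RV P >-> nat}) (F : R -> R) (c : R) : Prop :=
  0 < c < 1 /\ forall x : R, 0 < x -> pgf N (F x) = (F (c * x))%:E.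

(* The limit 0 at -oo follows from the last condition. *)
Definition continuous_df_pos (R : realType) (F : R -> R) : Prop :=
  [/\ {homo F : x y / x <= y}, continuous F,
      F x @[x --> +oo] --> (1 : R) & forall x : R, x <= 0 -> F x = 0].

(* Only the values of [psi] on (0, oo) are constrained and used. *)
Definition semi_weibull (R : realType) (F : R -> R) (p alpha : R) : Prop :=
  [/\ 0 < p < 1, 0 < alpha, continuous_df_pos F &
      exists psi : R -> R,
        [/\ forall x : R, 0 < x -> 0 <= psi x,
            forall x : R, 0 < x -> psi x = psi (p `^ alpha^-1 * x) / p &
            forall x : R, 0 < x -> F x = 1 - expR (- psi x)]].

(* Main.v *)
(** Writing [G = 1 - F], the Sibuya generating function turns max-stability into
    [G x `^ v = G (c * x)].  If [G] vanished at some [x > 0] it would vanish at every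
    [c ^+ n * x], hence at [0] by continuity, although [G 0 = 1] since [X > 0].  So
    [G > 0] on the positive half-line, and [psi := - ln G] converts the equation
    into [v * psi x = psi (c * x)], where [c = v `^ alpha^-1]. *)

Require Import Defs.
From HB Require Import structures.
From mathcomp Require Import all_boot all_order all_algebra.
From mathcomp Require Import all_classical all_reals all_analysis.
Import Order.TTheory GRing.Theory Num.Theory.
Import numFieldTopology.Exports numFieldNormedType.Exports.
Local Open Scope classical_set_scope.
Local Open Scope ring_scope.

Set Implicit Arguments.

Section distr_fun_properties.
Context d (T : measurableType d) (R : realType) (P : probability T R).
Implicit Type X : {RV P >-> R}.

Lemma distr_fun_ge0 X x : 0 <= distr_fun X x.
Proof. exact/fine_ge0/cdf_ge0. Qed.

Lemma distr_fun_le1 X x : distr_fun X x <= 1.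
Proof.
by rewrite -lee_fin /distr_fun fineK ?fin_num_measure//; exact: cdf_le1.
Qed.

Lemma distr_fun_nondecreasing X : {homo distr_fun X : x y / x <= y}.
Proof.
by move=> x y xy; rewrite fine_le ?fin_num_measure//; exact: cdf_nondecreasing.
Qed.

Lemma cvg_distr_funy1 X : distr_fun X x @[x --> +oo] --> (1 : R).
Proof. exact/fine_cvg/cvg_cdfy1. Qed.

(** For [x <= 0] the event [X <= x] sits inside the null set where [0 < X] fails. *)
Lemma distr_fun_eq0 X x : {ae P, forall t, 0 < X t} -> x <= 0 ->
  distr_fun X x = 0.
Proof.
move=> X_gt0 x0; rewrite /distr_fun /cdf /distribution /pushforward.
rewrite measure_negligible//.
  by rewrite -[_ @^-1` _]setTI; exact: measurable_funP.
apply: negligibleS X_gt0 => t /=; rewrite in_itv/= => Xtx.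
by apply/negP; rewrite -leNgt (le_trans Xtx).
Qed.

Lemma continuous_df_pos_distr_fun X : {ae P, forall t, 0 < X t} ->
  continuous (distr_fun X) -> continuous_df_pos (distr_fun X).
Proof.
move=> X_gt0 X_cont; split => //.
- exact: distr_fun_nondecreasing.
- exact: cvg_distr_funy1.
- by move=> x; exact: distr_fun_eq0.
Qed.

End distr_fun_properties.

Section powR_exponent.
Context {R : realType}.
Implicit Types a c v : R.

Lemma powR_exponent_unique c v : 0 < c < 1 -> 0 < v < 1 ->
  exists! a, 0 < a /\ c `^ a = v.
Proof.
move=> c01 v01; have /andP[c0 c1] := c01; have /andP[v0 v1] := v01.
have lnc0 := ln_lt0 c01; have lnv0 := ln_lt0 v01.
exists (ln v / ln c); split=> [|a [_ <-]].
  split; first by rewrite nmulr_rgt0// invr_lt0.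
  by rewrite /powR gt_eqF// mulfVK ?lt_eqF// lnK ?posrE.
by rewrite ln_powR mulfK// lt_eqF.
Qed.

Lemma powRK a c : 0 <= c -> a != 0 -> (c `^ a) `^ a^-1 = c.
Proof. by move=> c0 a0; rewrite -powRrM mulfV// powRr1. Qed.

Lemma powR_invK a v : 0 <= v -> a != 0 -> (v `^ a^-1) `^ a = v.
Proof. by move=> v0 a0; rewrite -powRrM mulVf// powRr1. Qed.

Lemma powR_in01 a v : 0 < a -> 0 < v < 1 -> 0 < v `^ a < 1.
Proof.
move=> a0 /andP[v0 v1]; rewrite powR_gt0//=.
have <- : 1 `^ a = 1 :> R by rewrite powR1.
by rewrite gt0_ltr_powR// nnegrE ltW.
Qed.

End powR_exponent.

Section sibuya_max_stable.
Context d (T : measurableType d) (R : realType) (P : probability T R).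
Variables (N : {RV P >-> nat}) (v : R) (F : R -> R).
Hypotheses (N_sibuya : sibuya N v) (v01 : 0 < v < 1).
Hypotheses (F_ge0 : forall x, 0 <= F x) (F_le1 : forall x, F x <= 1).

(** The generating function is prescribed only on [[0, 1]]; the bounds on [F] allow its evaluation
    at [F x], and the outer [1 - _] cancels on both sides. *)
Lemma sibuya_max_stableE c : N_max_stable N F c <->
  0 < c < 1 /\ forall x, 0 < x -> (1 - F x) `^ v = 1 - F (c * x).
Proof.
split=> -[c01 FE]; split => // x x0; have := FE x x0.
- by rewrite N_sibuya ?F_ge0 ?F_le1// => -[<-]; rewrite subKr.
- by rewrite N_sibuya ?F_ge0 ?F_le1// => ->; rewrite subKr.
Qed.

Lemma sibuya_max_stable_lt1 c : continuous F -> F 0 = 0 ->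
  N_max_stable N F c -> forall x, 0 < x -> F x < 1.
Proof.
move=> F_cont F0 /sibuya_max_stableE[/andP[c0 c1] FE] x x0.
rewrite lt_neqAle F_le1 andbT; apply/eqP => Fx1.
have Fn n : F (c ^+ n * x) = 1.
  elim: n => [|n IH]; first by rewrite expr0 mul1r.
  have := FE (c ^+ n * x) _; rewrite mulr_gt0 ?exprn_gt0// => /(_ isT).
  (* [0]^ v = 0[relies on]v != 0[, since]0 [^ 0 = 1]. *)
  rewrite IH subrr powR0; last by rewrite gt_eqF//; case/andP: v01.
  by rewrite exprS -mulrA => /esym/subr0_eq.
have cvg0 : (c ^+ n * x) @[n --> \oo] --> (0 : R).
  rewrite -[X in _ --> X](mul0r x); apply: cvgMr_tmp.
  by apply: cvg_expr; rewrite gtr0_norm.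
(* Continuity at [0] forces the sequence, constantly [1], to converge to [F 0 = 0]. *)
have : F (c ^+ n * x) @[n --> \oo] --> F 0.
  exact: (cvg_comp _ _ cvg0 (F_cont 0)).
under eq_fun do rewrite Fn.
rewrite F0 => /(cvg_lim (@Rhausdorff R)); rewrite lim_cst// => /eqP.
by rewrite oner_eq0.
Qed.

Lemma sibuya_max_stable_semi_weibull (a c : R) : continuous_df_pos F ->
  0 < a -> c `^ a = v -> N_max_stable N F c -> semi_weibull F v a.
Proof.
move=> Fdf a0 cv FN; have [_ F_cont _ F0] := Fdf.
have F_lt1 := sibuya_max_stable_lt1 F_cont (F0 _ (lexx _)) FN.
have /sibuya_max_stableE[/andP[c0 c1] FE] := FN.
have /andP[v0 _] := v01.
split => //; exists (fun x => - ln (1 - F x)); split=> x x0.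
- by rewrite oppr_ge0 ln_le0// gerBl.
- rewrite -{1}cv powRK ?gt_eqF ?(ltW c0)// -FE// ln_powR.
  by rewrite mulNr mulrAC mulfV ?mul1r// gt_eqF.
(* The logarithm can be undone because [1 - F x] is strictly positive. *)
- by rewrite opprK lnK ?posrE ?subr_gt0 ?F_lt1// subKr.
Qed.

Lemma semi_weibull_sibuya_max_stable a c : 0 < c < 1 -> c `^ a = v ->
  semi_weibull F v a -> N_max_stable N F c.
Proof.
move=> c01 cv [_ a0 _ [psi [_ psiE FE]]]; apply/sibuya_max_stableE.
have /andP[c0 _] := c01; have /andP[v0 _] := v01.
split => // x x0; rewrite !FE ?mulr_gt0// !subKr.
rewrite -expRM; congr expR.
rewrite psiE// -[X in X `^ a^-1]cv powRK ?gt_eqF ?(ltW c0)//.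
by rewrite mulNr divfK// gt_eqF.
Qed.

End sibuya_max_stable.

Unset Implicit Arguments.

Theorem mainTheorem2 (R : realType) (d : measure_display)
    (T : measurableType d) (P : probability T R)
    (X : {RV P >-> R}) (N : {RV P >-> nat}) (v : R)
    (X_gt0 : {ae P, forall t, 0 < X t})
    (X_cont : continuous (distr_fun X))
    (v01 : 0 < v < 1)
    (N_gt0 : {ae P, forall t, (0 < N t)%N})
    (N_sibuya : sibuya N v)
    (XN_indep : independent_RV X N) :
  (forall c : R, 0 < c < 1 ->
     (exists! alpha : R, 0 < alpha /\ c `^ alpha = v) /\
     (forall alpha : R, 0 < alpha -> c `^ alpha = v ->
        (N_max_stable N (distr_fun X) c <->
         semi_weibull (distr_fun X) v alpha)))
  /\
  ((exists c : R, 0 < c < 1 /\ N_max_stable N (distr_fun X) c) <->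
   (exists alpha : R, 0 < alpha /\ semi_weibull (distr_fun X) v alpha)).
Proof.
have F_ge0 := distr_fun_ge0 X; have F_le1 := distr_fun_le1 X.
have Fdf := continuous_df_pos_distr_fun X_gt0 X_cont.
have equiv (c a : R) : 0 < c < 1 -> 0 < a -> c `^ a = v ->
    N_max_stable N (distr_fun X) c <-> semi_weibull (distr_fun X) v a.
  move=> c01 a0 cv; split; first exact: sibuya_max_stable_semi_weibull.
  exact: semi_weibull_sibuya_max_stable.
split=> [c c01|].
  by split=> [|a a0 cv]; [exact: powR_exponent_unique|exact: equiv].
split=> [[c [c01 Fc]]|[a [a0 Fa]]].
  (* Here [c] is given and the exponent is solved for. *)
  have [a [[a0 cv] _]] := powR_exponent_unique _ _ c01 v01.
  by exists a; split => //; apply/(equiv c).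
(* Conversely the exponent [a] is given, and [v]^ a^-1[is the]c[that solves]c [^ a = v]. *)
have c01 : 0 < v `^ a^-1 < 1 by apply: powR_in01; rewrite ?invr_gt0.
exists (v `^ a^-1); split => //; apply/(equiv _ a) => //.
by apply: powR_invK; rewrite ?gt_eqF//; case/andP: v01 => /ltW.
Qed.
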